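(* Let $R=\mathbb{F}_1\times\cdots\times\mathbb{F}_t$ where $\mathbb{F}_j$ is a finite field for all $j=1,\dots,t$, and let $\Sigma^{\mathfrak{C}}=(A,B,C,D)$ be an input/state/output representation of a family of convolutional codes $\mathfrak{C}$ over $R$. If $\Sigma^{\mathfrak{C}}$ is a reachable and observable linear system over $R$, then $\mathfrak{C}$ is an observable family of convolutional codes over $R$.
   Context: Kernel of a pair: for $R$-linear maps (or matrices over $R[z]$) $f_1:M_1\to N$ and $f_2:M_2\to N$, put $\mathrm{Ker}(f_1\mid f_2):=\{m_2\in M_2 : \exists m_1\in M_1,\ f_1(m_1)+f_2(m_2)=0\}$. Convolutional codes: for $k\le n$, an $(n,k)$ family of convolutional codes over $R$ is a free $R[z]$-submodule $\mathfrak{C}\subset R[z]^n$ of rank $k$ such that $R[z]^n/\mathfrak{C}$ is flat over $R$. It is called observable if $R[z]^n/\mathfrak{C}$ is flat over $R[z]$. For a prime $\mathfrak{p}$ of $R$ with residue field $k(\mathfrak{p})$, $\mathfrak{C}(\mathfrak{p}):=\mathfrak{C}\otimes_R k(\mathfrak{p})$ is a rank $k$ submodule of $k(\mathfrak{p})[z]^n$; its degree is the highest degree of the $k\times k$ minors of any $n\times k$ matrix over $k(\mathfrak{p})[z]$ whose columns generate $\mathfrak{C}(\mathfrak{p})$. Standing assumption: the degree function $\mathfrak{p}\mapsto\deg\mathfrak{C}(\mathfrak{p})$ on $\mathrm{Spec}(R)$ is constant, with value $\delta$. First order representations: a first order representation of an $(n,k)$ code $\mathfrak{C}$ of degree $\delta$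 over $R$ is a triple $(K,L,M)$ with $K,L\in \mathrm{Mat}_{(\delta+n-k)\times\delta}(R)$, $M\in \mathrm{Mat}_{(\delta+n-k)\times n}(R)$ and $\mathfrak{C}=\mathrm{Ker}(zK+L\mid M)$. It is minimal if: (1) $K:R^\delta\to R^{\delta+n-k}$ is injective with $R$-flat cokernel; (2) $(K,M):R^{\delta+n}\to R^{\delta+n-k}$ is surjective; (3) $(zK+L,M):R[z]^{\delta+n}\to R[z]^{\delta+n-k}$ is surjective. I/S/O representation: an input/state/output representation of $\mathfrak{C}$ is a quadruple $(A,B,C,D)$ with $A\in \mathrm{Mat}_{\delta\times\delta}(R)$, $B\in \mathrm{Mat}_{\delta\times k}(R)$, $C\in \mathrm{Mat}_{(n-k)\times\delta}(R)$, $D\in \mathrm{Mat}_{(n-k)\times k}(R)$ obtained from a minimal first order representation $(K,L,M)$ of $\mathfrak{C}$ as follows: there are $W\in GL_{\delta+n-k}(R)$ and $P\in GL_n(R)$, with the image of $P$ in each $GL_n(\mathbb{F}_j)$ a permutation matrix (reordering of codeword coordinates), such that $$WK=\begin{pmatrix}-\mathrm{Id}_\delta\\ O\end{pmatrix},\quad WL=\begin{pmatrix}A\\ C\end{pmatrix},\quad WMP=\begin{pmatrix}O & B\\ -\mathrm{Id}_{n-k} & D\end{pmatrix}.$$ A linear system $(A,B,C,D)$ over $R$ with $A$ of size $\delta\times\delta$ is reachable if the controllability matrix $\Phi_\delta(A,B):=(B,AB,\dots,A^{\delta-1}B)$ is surjective, and observable if the observability matrix $\Omega_\delta(A,C)$,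 obtained by stacking the blocks $C,CA,\dots,CA^{\delta-1}$ vertically, is injective as a map on $R^\delta$. *)

(* Defs.v *)
From HB Require Import structures.
From mathcomp Require Import all_boot all_order all_algebra all_field.
From mathcomp Require Import generic_quotient ring_quotient fraction.
From mathcomp Require Import boolp.
From mathcomp Require Import freeg.

Set Implicit Arguments.
Unset Strict Implicit.
Unset Printing Implicit Defensive.

Import GRing.Theory.
Local Open Scope ring_scope.
Local Open Scope quotient_scope.

Section QuotientModule.
Variables (R : nzRingType) (V : lmodType R) (U : submodClosed V).

(* submodClosed only records closure under addition and scaling, so closure
   under opposite has to be declared before the library's quotient applies. *)
Definition submod_pred : {pred V} := U.

Fact submod_pred_closed : zmod_closed submod_pred.
Proof. exact: GRing.submod_closedB (submodClosedP U). Qed.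

HB.instance Definition _ :=
  GRing.isZmodClosed.Build V submod_pred submod_pred_closed.

Definition quotmod : Type := Quotient.quot submod_pred.

HB.instance Definition _ := GRing.Zmodule.on quotmod.

Definition quotmod_pi (v : V) : quotmod := \pi_(Quotient.quot submod_pred) v.

Lemma quotmod_piP (x : quotmod) : exists v, x = quotmod_pi v.
Proof.
by exists (repr (x : Quotient.quot submod_pred)); rewrite /quotmod_pi reprK.
Qed.

Lemma quotmod_pi_eq u v : quotmod_pi u = quotmod_pi v <-> u - v \in U.
Proof.
rewrite -[_ \in U]/(u - v \in submod_pred) Quotient.idealrBE.
by split=> [/eqP|/eqP].
Qed.

Fact quotmod_piD : {morph quotmod_pi : u v / u + v}.
Proof. by move=> u v; rewrite /quotmod_pi raddfD. Qed.

Definition quotmod_scale (a : R) (x : quotmod) : quotmod :=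
  quotmod_pi (a *: repr (x : Quotient.quot submod_pred)).

Fact quotmod_scale_pi a v : quotmod_scale a (quotmod_pi v) = quotmod_pi (a *: v).
Proof.
apply/quotmod_pi_eq; rewrite -scalerBr; apply: rpredZ.
by apply/quotmod_pi_eq; rewrite {1}/quotmod_pi reprK.
Qed.

Fact quotmod_scaleA a b x :
  quotmod_scale a (quotmod_scale b x) = quotmod_scale (a * b) x.
Proof. by have [v ->] := quotmod_piP x; rewrite !quotmod_scale_pi scalerA. Qed.

Fact quotmod_scale1 : left_id 1 quotmod_scale.
Proof.
by move=> x; have [v ->] := quotmod_piP x; rewrite quotmod_scale_pi scale1r.
Qed.

Fact quotmod_scaleDr : right_distributive quotmod_scale +%R.
Proof.
move=> a x y; have [u ->] := quotmod_piP x; have [v ->] := quotmod_piP y.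
by rewrite -quotmod_piD !quotmod_scale_pi -quotmod_piD scalerDr.
Qed.

Fact quotmod_scaleDl x : {morph quotmod_scale^~ x : a b / a + b}.
Proof.
move=> a b; have [v ->] := quotmod_piP x.
by rewrite !quotmod_scale_pi -quotmod_piD scalerDl.
Qed.

HB.instance Definition _ := GRing.Zmodule_isLmodule.Build R quotmod
  quotmod_scaleA quotmod_scale1 quotmod_scaleDr quotmod_scaleDl.

Fact quotmod_pi_is_linear : linear quotmod_pi.
Proof. by move=> a u v; rewrite quotmod_piD -quotmod_scale_pi. Qed.

HB.instance Definition _ :=
  GRing.isLinear.Build R V quotmod *:%R quotmod_pi quotmod_pi_is_linear.

End QuotientModule.

Section Span.
Variables (R : nzRingType) (V : lmodType R) (S : V -> Prop).

Definition spanmod : {pred V} := fun v =>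
  `[< forall W : submodClosed V, (forall w, S w -> w \in W) -> v \in W >].

Fact spanmod_closed : submod_closed spanmod.
Proof.
split=> [|a u v /asboolP uS /asboolP vS]; apply/asboolP => W SW.
  exact: rpred0.
by rewrite rpredD ?rpredZ ?uS ?vS.
Qed.

HB.instance Definition _ :=
  GRing.isSubmodClosed.Build R V spanmod (GRing.submod_closed_semi spanmod_closed).

End Span.

Section Flat.
Variable R : comNzRingType.

(* M (x)_R N as the free R-module on M * N modulo the bilinearity relations. *)
Section Tensor.
Variables M N : lmodType R.

Definition free_tens (m : M) (n : N) : {freeg (M * N)%type / R} := << (m, n) >>.

Inductive bilin_rel : {freeg (M * N)%type / R} -> Prop :=
| BilinDl m m' n :
    bilin_rel (free_tens (m + m') n - (free_tens m n + free_tens m' n))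
| BilinDr m n n' :
    bilin_rel (free_tens m (n + n') - (free_tens m n + free_tens m n'))
| BilinZl a m n : bilin_rel (free_tens (a *: m) n - a *: free_tens m n)
| BilinZr a m n : bilin_rel (free_tens m (a *: n) - a *: free_tens m n).

Definition tensor : Type := quotmod (spanmod bilin_rel).

HB.instance Definition _ := GRing.Lmodule.on tensor.

Definition tens (m : M) (n : N) : tensor := quotmod_pi _ (free_tens m n).

Fact quotmod_pi_rel x y :
  bilin_rel (x - y) -> quotmod_pi (spanmod bilin_rel) x = quotmod_pi _ y.
Proof. by move=> xy; apply/quotmod_pi_eq/asboolP => W; apply. Qed.

Lemma tensDl m m' n : tens (m + m') n = tens m n + tens m' n.
Proof. by rewrite /tens -quotmod_piD; apply/quotmod_pi_rel/BilinDl. Qed.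

Lemma tensDr m n n' : tens m (n + n') = tens m n + tens m n'.
Proof. by rewrite /tens -quotmod_piD; apply/quotmod_pi_rel/BilinDr. Qed.

Lemma tensZl a m n : tens (a *: m) n = a *: tens m n.
Proof.
rewrite -[RHS]/(quotmod_scale a (quotmod_pi _ _)) quotmod_scale_pi.
exact/quotmod_pi_rel/BilinZl.
Qed.

Lemma tensZr a m n : tens m (a *: n) = a *: tens m n.
Proof.
rewrite -[RHS]/(quotmod_scale a (quotmod_pi _ _)) quotmod_scale_pi.
exact/quotmod_pi_rel/BilinZr.
Qed.

End Tensor.

Fact fglift_is_linear (K : choiceType) (V : lmodType R) (g : K -> V) :
  linear (fglift g : {freeg K / R} -> V).
Proof.
have gB : {morph (fglift g : {freeg K / R} -> V) : x y / x - y}.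
  exact: lift_is_additive.
have g0 : fglift g (0 : {freeg K / R}) = 0 by rewrite -(subrr 0) gB subrr.
have gD : {morph (fglift g : {freeg K / R} -> V) : x y / x + y}.
  move=> x y; have gN : fglift g (- y) = - fglift g y by rewrite -sub0r gB g0 sub0r.
  by rewrite -{1}[y]opprK gB gN opprK.
move=> a x y; rewrite gD; congr (_ + _); rewrite -{1 2}[x]freeg_sumE.
rewrite scaler_sumr !(big_morph _ gD g0) scaler_sumr; apply: eq_bigr => z _.
have -> : a *: << coeff z x *g z >> = << a * coeff z x *g z >> :> {freeg K / R}.
  by apply/eqP/freeg_eqP => t; rewrite coeffZ !coeffU mulrA.
by rewrite !liftU scalerA.
Qed.

Section TensorMap.
Variables (M N N' : lmodType R) (f : {linear N -> N'}).

Definition free_tensor_map : {freeg (M * N)%type / R} -> tensor M N' :=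
  fglift (fun mn : M * N => tens mn.1 (f mn.2)).

HB.instance Definition _ :=
  GRing.isLinear.Build R {freeg (M * N)%type / R} (tensor M N') *:%R
    free_tensor_map (fglift_is_linear _).

(* id_M (x) f; the choice of a representative is irrelevant by tensor_map_pi. *)
Definition tensor_map (x : tensor M N) : tensor M N' :=
  free_tensor_map
    (repr (x : Quotient.quot (submod_pred (spanmod (@bilin_rel M N))))).

Definition free_tensor_ker : {pred {freeg (M * N)%type / R}} :=
  fun x => free_tensor_map x == 0.

Fact free_tensor_ker_closed : submod_closed free_tensor_ker.
Proof.
split=> [|a x y /eqP fx /eqP fy]; apply/eqP; first exact: linear0.
by rewrite linearP /= fx fy scaler0 addr0.
Qed.

HB.instance Definition _ := GRing.isSubmodClosed.Build R _ free_tensor_ker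
  (GRing.submod_closed_semi free_tensor_ker_closed).


Lemma free_tensor_map_pure m n : free_tensor_map (free_tens m n) = tens m (f n).
Proof. by rewrite /free_tensor_map liftU scale1r. Qed.

Lemma free_tensor_map_rel x : bilin_rel x -> free_tensor_map x = 0.
Proof.
case=> [m m' n|m n n'|a m n|a m n]; rewrite linearB /=.
- by rewrite linearD /= !free_tensor_map_pure tensDl subrr.
- by rewrite linearD /= !free_tensor_map_pure linearD tensDr subrr.
- by rewrite linearZ /= !free_tensor_map_pure tensZl subrr.
- by rewrite linearZ /= !free_tensor_map_pure linearZ tensZr subrr.
Qed.

Lemma tensor_map_pi x :
  tensor_map (quotmod_pi (spanmod (@bilin_rel M N)) x) = free_tensor_map x.
Proof.
apply/eqP; rewrite -subr_eq0 -linearB; set y := _ - _.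
have /asboolP/(_ free_tensor_ker) : y \in spanmod (@bilin_rel M N).
  by apply/quotmod_pi_eq; rewrite {1}/quotmod_pi reprK.
by apply=> w /free_tensor_map_rel/eqP.
Qed.

End TensorMap.

Definition flat (M : lmodType R) : Prop :=
  forall (N N' : lmodType R) (f : {linear N -> N'}),
    injective f -> injective (tensor_map (M := M) f).

End Flat.

Section RestrictScalars.
Variables (R : comNzRingType) (V : lmodType {poly R}).

(* V as an R-module through the embedding R -> R[z]. *)
Definition restrict_scalars : Type := V.

HB.instance Definition _ := GRing.Zmodule.on restrict_scalars.

Definition restrict_scale (a : R) (v : restrict_scalars) : restrict_scalars :=
  a%:P *: (v : V).

Fact restrict_scaleA a b v :
  restrict_scale a (restrict_scale b v) = restrict_scale (a * b) v.
Proof. by rewrite /restrict_scale scalerA polyCM. Qed.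

Fact restrict_scale1 : left_id 1 restrict_scale.
Proof. by move=> v; rewrite /restrict_scale scale1r. Qed.

Fact restrict_scaleDr : right_distributive restrict_scale +%R.
Proof. by move=> a u v; exact: scalerDr. Qed.

Fact restrict_scaleDl v : {morph restrict_scale^~ v : a b / a + b}.
Proof. by move=> a b; rewrite /restrict_scale polyCD; exact: scalerDl. Qed.

HB.instance Definition _ := GRing.Zmodule_isLmodule.Build R restrict_scalars
  restrict_scaleA restrict_scale1 restrict_scaleDr restrict_scaleDl.

End RestrictScalars.

Section ResidueField.
Variables (R : comNzRingType) (p : prime_idealr R).

Definition prime_quot : Type := {ideal_quot p}.

HB.instance Definition _ := GRing.ComNzRing.on prime_quot.

(* Integral domains of the library carry a partial inverse, for which R/p has
   no canonical choice. *)
Definition prime_quot_unit : {pred prime_quot} :=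
  fun x => `[< exists y, y * x = 1 >].

Definition prime_quot_inv (x : prime_quot) : prime_quot :=
  if pselect (exists y, y * x = 1) is left yx then projT1 (cid yx) else x.

Fact prime_quot_mulVr : {in prime_quot_unit, left_inverse 1 prime_quot_inv *%R}.
Proof.
move=> x /asboolP ux; rewrite /prime_quot_inv.
by case: pselect => // yx; case: (cid yx).
Qed.

Fact prime_quot_unitP x y : y * x = 1 -> prime_quot_unit x.
Proof. by move=> yx; apply/asboolP; exists y. Qed.

Fact prime_quot_inv_out : {in [predC prime_quot_unit], prime_quot_inv =1 id}.
Proof.
move=> x /negP xNu; rewrite /prime_quot_inv.
by case: pselect => // yx; case: xNu; apply/asboolP.
Qed.

HB.instance Definition _ := GRing.ComNzRing_hasMulInverse.Build prime_quot
  prime_quot_mulVr prime_quot_unitP prime_quot_inv_out.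

HB.instance Definition _ := GRing.ComUnitRing_isIntegral.Build prime_quot
  (@Quotient.rquot_IdomainAxiom R p).

Definition residue_field : fieldType := {fraction prime_quot}.

Definition residue (a : R) : residue_field :=
  FracField.tofrac (\pi_{ideal_quot p} a : prime_quot).

Fact residue_is_zmod_morphism : zmod_morphism residue.
Proof. by move=> a b; rewrite /residue !raddfB. Qed.

Fact residue_is_monoid_morphism : monoid_morphism residue.
Proof. by split=> [|a b]; rewrite /residue ?rmorph1 ?rmorphM. Qed.

HB.instance Definition _ :=
  GRing.isZmodMorphism.Build R residue_field residue residue_is_zmod_morphism.
HB.instance Definition _ :=
  GRing.isMonoidMorphism.Build R residue_field residue residue_is_monoid_morphism.

End ResidueField.

Section MatrixMaps.
Variables (R : comNzRingType) (m n : nat).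

Definition mx_injective (A : 'M[R]_(m, n)) : Prop :=
  injective (mulmx A : 'cV[R]_n -> 'cV[R]_m).

Definition mx_surjective (A : 'M[R]_(m, n)) : Prop :=
  forall w : 'cV[R]_m, exists v : 'cV[R]_n, A *m v = w.

Variable A : 'M[R]_(m, n).

Definition mx_image : {pred 'cV[R]_m} :=
  fun w => `[< exists v : 'cV[R]_n, w = A *m v >].

Fact mx_image_closed : submod_closed mx_image.
Proof.
split=> [|a u v /asboolP [x ->] /asboolP [y ->]]; apply/asboolP.
  by exists 0; rewrite mulmx0.
by exists (a *: x + y); rewrite mulmxDr scalemxAr.
Qed.

HB.instance Definition _ := GRing.isSubmodClosed.Build R _ mx_image
  (GRing.submod_closed_semi mx_image_closed).

Definition mx_coker : Type := quotmod mx_image.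

HB.instance Definition _ := GRing.Lmodule.on mx_coker.

End MatrixMaps.

(* Ker(f1 | f2) *)
Definition kerpair (S : comNzRingType) (q m1 m2 : nat)
    (f1 : 'M[S]_(q, m1)) (f2 : 'M[S]_(q, m2)) (v : 'cV[S]_m2) : Prop :=
  exists u : 'cV[S]_m1, f1 *m u + f2 *m v = 0.

Section ConvolutionalCodes.
Variables (R : comNzRingType) (n k : nat).
Variable C : submodClosed 'cV[{poly R}]_n.

Definition free_of_rank : Prop :=
  exists G : 'M[{poly R}]_(n, k), mx_injective G /\ mx_image G =i C.

Definition conv_code : Prop :=
  [/\ (k <= n)%N, free_of_rank & flat (restrict_scalars (quotmod C))].

Definition observable_conv_code : Prop := conv_code /\ flat (quotmod C).

(* C(p), identified with its image in k(p)[z]^n: a finite sum of pure tensors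
   c (x) a is sent to the sum of the a c(p), where c(p) is c reduced modulo p. *)
Definition fiber (p : prime_idealr R) (w : 'cV[{poly residue_field p}]_n) : Prop :=
  exists2 s : seq (residue_field p * 'cV[{poly R}]_n),
    {in s, forall ac, ac.2 \in C} &
    w = \sum_(ac <- s) (ac.1)%:P *: map_mx (map_poly (residue p)) ac.2.

(* Minors are indexed by the increasing k-tuples of rows. *)
Definition max_minor_degree (K : fieldType) (G : 'M[{poly K}]_(n, k)) : nat :=
  \max_(f : {ffun 'I_k -> 'I_n} |
          [forall i : 'I_k, forall j : 'I_k, (i < j)%N ==> (f i < f j)%N])
    (size (\det (rowsub f G))).-1.

Definition fiber_degree (p : prime_idealr R) (d : nat) : Prop :=
  exists2 G : 'M[{poly residue_field p}]_(n, k),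
    (forall w, fiber w <-> w \in mx_image G) & max_minor_degree G = d.

Definition constant_degree (d : nat) : Prop :=
  forall p : prime_idealr R, fiber_degree p d.

End ConvolutionalCodes.

Section FirstOrder.
Variables (R : comNzRingType) (n k d : nat).
Implicit Types (K L : 'M[R]_(d + (n - k), d)) (M : 'M[R]_(d + (n - k), n)).

Definition pencil K L : 'M[{poly R}]_(d + (n - k), d) :=
  'X *: map_mx polyC K + map_mx polyC L.

Definition first_order_rep (C : submodClosed 'cV[{poly R}]_n) K L M : Prop :=
  forall v : 'cV[{poly R}]_n, v \in C <-> kerpair (pencil K L) (map_mx polyC M) v.

Definition minimal_first_order K L M : Prop :=
  [/\ mx_injective K /\ flat (mx_coker K),
      mx_surjective (row_mx K M)
    & mx_surjective (row_mx (pencil K L) (map_mx polyC M))].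

End FirstOrder.

Section LinearSystems.
Variables (R : comNzRingType) (d k r : nat).

Definition controllability_mx (A : 'M[R]_d) (B : 'M[R]_(d, k)) :
    'M[R]_(d, \sum_(i < d) k) :=
  \mxrow_(i < d) (A ^+ i *m B).

Definition observability_mx (A : 'M[R]_d) (C : 'M[R]_(r, d)) :
    'M[R]_(\sum_(i < d) r, d) :=
  \mxcol_(i < d) (C *m A ^+ i).

Definition reachable (A : 'M[R]_d) (B : 'M[R]_(d, k)) : Prop :=
  mx_surjective (controllability_mx A B).

Definition observable (A : 'M[R]_d) (C : 'M[R]_(r, d)) : Prop :=
  mx_injective (observability_mx A C).

End LinearSystems.

Section FieldProduct.
Variables (t : nat) (F : 'I_t.+1 -> finFieldType).

(* F_0 x ... x F_t; there is at least one factor since rings are nontrivial. *)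
Definition field_prod : Type := {dffun forall j : 'I_t.+1, F j}.

HB.instance Definition _ := Choice.on field_prod.

Implicit Types x y : field_prod.

Definition prod_proj (j : 'I_t.+1) (x : field_prod) : F j := x j.

Definition prod_tuple (f : forall j, F j) : field_prod := finfun f.

Lemma prod_tupleE f j : prod_proj j (prod_tuple f) = f j.
Proof. exact: ffunE. Qed.

Lemma prod_ext x y : (forall j, prod_proj j x = prod_proj j y) -> x = y.
Proof. by move=> xy; apply/ffunP. Qed.

Definition prod_zero : field_prod := prod_tuple (fun j => 0).
Definition prod_one : field_prod := prod_tuple (fun j => 1).
Definition prod_opp x : field_prod := prod_tuple (fun j => - x j).
Definition prod_add x y : field_prod := prod_tuple (fun j => x j + y j).
Definition prod_mul x y : field_prod := prod_tuple (fun j => x j * y j).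

Fact prod_addA : associative prod_add.
Proof. by move=> x y z; apply: prod_ext => j; rewrite /prod_proj !ffunE addrA. Qed.

Fact prod_addC : commutative prod_add.
Proof. by move=> x y; apply: prod_ext => j; rewrite /prod_proj !ffunE addrC. Qed.

Fact prod_add0 : left_id prod_zero prod_add.
Proof. by move=> x; apply: prod_ext => j; rewrite /prod_proj !ffunE add0r. Qed.

Fact prod_addN : left_inverse prod_zero prod_opp prod_add.
Proof. by move=> x; apply: prod_ext => j; rewrite /prod_proj !ffunE addNr. Qed.

HB.instance Definition _ := GRing.isZmodule.Build field_prod
  prod_addA prod_addC prod_add0 prod_addN.

Fact prod_mulA : associative prod_mul.
Proof. by move=> x y z; apply: prod_ext => j; rewrite /prod_proj !ffunE mulrA. Qed.

Fact prod_mulC : commutative prod_mul.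
Proof. by move=> x y; apply: prod_ext => j; rewrite /prod_proj !ffunE mulrC. Qed.

Fact prod_mul1 : left_id prod_one prod_mul.
Proof. by move=> x; apply: prod_ext => j; rewrite /prod_proj !ffunE mul1r. Qed.

Fact prod_mulDl : left_distributive prod_mul +%R.
Proof. by move=> x y z; apply: prod_ext => j; rewrite /prod_proj !ffunE mulrDl. Qed.

Fact prod_one_neq0 : prod_one != 0.
Proof.
apply/eqP => /(congr1 (prod_proj ord0)) /eqP.
by rewrite /prod_proj !ffunE oner_eq0.
Qed.

HB.instance Definition _ := GRing.Zmodule_isComNzRing.Build field_prod
  prod_mulA prod_mulC prod_mul1 prod_mulDl prod_one_neq0.

Definition prod_unit : {pred field_prod} := fun x => [forall j, x j != 0].
Definition prod_inv x : field_prod :=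
  if prod_unit x then prod_tuple (fun j => (x j)^-1) else x.

Fact prod_mulVr : {in prod_unit, left_inverse 1 prod_inv *%R}.
Proof.
move=> x ux; rewrite /prod_inv [prod_unit x]ux; apply: prod_ext => j.
by move/forallP: ux => /(_ j) xj; rewrite /prod_proj !ffunE mulVf.
Qed.

Fact prod_unitP x y : y * x = 1 -> prod_unit x.
Proof.
move=> yx; apply/forallP => j; apply/eqP => xj0; have /eqP := prod_one_neq0.
move: yx => /(congr1 (prod_proj j)); rewrite /prod_proj !ffunE xj0 mulr0.
by move=> /eqP; rewrite eq_sym oner_eq0.
Qed.

Fact prod_inv_out : {in [predC prod_unit], prod_inv =1 id}.
Proof. by move=> x /negPf; rewrite /prod_inv -topredE /= => ->. Qed.

HB.instance Definition _ := GRing.ComNzRing_hasMulInverse.Build field_prod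
  prod_mulVr prod_unitP prod_inv_out.

Fact prod_proj_is_zmod_morphism j : zmod_morphism (prod_proj j).
Proof. by move=> x y; rewrite /prod_proj !ffunE. Qed.

Fact prod_proj_is_monoid_morphism j : monoid_morphism (prod_proj j).
Proof. by split=> [|x y]; rewrite /prod_proj !ffunE. Qed.

HB.instance Definition _ j := GRing.isZmodMorphism.Build field_prod (F j)
  (prod_proj j) (prod_proj_is_zmod_morphism j).
HB.instance Definition _ j := GRing.isMonoidMorphism.Build field_prod (F j)
  (prod_proj j) (prod_proj_is_monoid_morphism j).

(* M *m P has n columns; castmx splits them as (n - k) + k. *)
Definition iso_representation (n k d : nat) (le_kn : (k <= n)%N)
    (C : submodClosed 'cV[{poly field_prod}]_n)
    (A : 'M[field_prod]_d) (B : 'M[field_prod]_(d, k))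
    (C' : 'M[field_prod]_(n - k, d)) (D : 'M[field_prod]_(n - k, k)) : Prop :=
  exists (K L : 'M[field_prod]_(d + (n - k), d))
         (M : 'M[field_prod]_(d + (n - k), n))
         (W : 'M[field_prod]_(d + (n - k))) (P : 'M[field_prod]_n),
    [/\ first_order_rep C K L M /\ minimal_first_order K L M,
        W \in unitmx,
        P \in unitmx /\ forall j, is_perm_mx (map_mx (prod_proj j) P)
      & [/\ W *m K = col_mx (- 1%:M) 0,
            W *m L = col_mx A C'
          & castmx (erefl, esym (subnK le_kn)) (W *m M *m P)
            = block_mx 0 B (- 1%:M) D]].

End FieldProduct.

(* Main.v *)
Require Import Defs.
From HB Require Import structures.
From mathcomp Require Import all_boot all_order all_algebra all_field.
From mathcomp Require Import boolp freeg.

Set Implicit Arguments.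
Unset Strict Implicit.
Unset Printing Implicit Defensive.

Import GRing.Theory.
Local Open Scope ring_scope.

(** Write R for the product of fields, z for the polynomial variable, and let
(K, L, M) be the first order representation behind (A, B, C, D). Only the
flatness of Q := R[z]^n / CC over R[z] is at stake, and Q is in fact projective.

The code is Ker(p | M) with p := zK + L, so v |-> M v embeds Q into the cokernel
of p, and minimality makes (p, M), hence this embedding, surjective. It remains
to see that coker p is projective, for which a left inverse of p suffices. Up to
the invertible W, p is the stack of A - z and C. Observability provides a left
inverse Y of the matrix with blocks C A^i: an injective matrix over R is
injective over each factor F_j, where linear algebra inverts it
([field_prod_mx_injective_linv]). Since A is congruent to z modulo A - z, each
C A^i is a left combination of C and A - z, and so is the identity, as a left
combination of the C A^i ([observability_linv_pencil]); this is the easy half of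
the Hautus test, and it holds over any commutative ring.

Given N with N p = 1, the matrix c := 1 - p N projects along the image of p. A
right inverse of (p, M), whose lower block is T, then turns T c M into an
idempotent endomorphism of R[z]^n with kernel CC ([flat_quotmod_kerpair]). Thus
Q is a direct factor of R[z]^n, and the coordinates of R[z]^n give it a finite
dual basis. A module with a finite dual basis (b_j, phi_j) is flat because x in
Q (x) X can be recovered from its contractions (phi_j (x) 1) x in X, and
contraction is natural in X ([flat_of_dual_basis]). *)

(** * Universal properties of quotients and tensor products *)

Lemma quotmod_lift (S : nzRingType) (V W : lmodType S) (U : submodClosed V)
    (g : {linear V -> W}) :
  (forall u, u \in U -> g u = 0) ->
  exists h : {linear quotmod U -> W}, forall v, h (quotmod_pi U v) = g v.
Proof.
move=> gU.
pose h (x : quotmod U) : W := g (projT1 (cid (quotmod_piP x))).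
have hE v : h (quotmod_pi U v) = g v.
  rewrite /h; case: cid => w /= /quotmod_pi_eq vw.
  by apply/esym/eqP; rewrite -subr_eq0 -linearB gU.
have hlin : linear h.
  move=> a x y; have [u ->] := quotmod_piP x; have [v ->] := quotmod_piP y.
  by rewrite -linearP !hE linearP.
pose Lh := GRing.isLinear.Build S (quotmod U) W *:%R h hlin.
pose hL : {linear quotmod U -> W} := HB.pack h Lh.
by exists hL.
Qed.

Section Tensors.
Variable S : comNzRingType.

Lemma freeg_linear_ext (T : choiceType) (V : lmodType S)
    (g h : {linear {freeg T / S} -> V}) :
  (forall t, g << t >> = h << t >>) -> g =1 h.
Proof.
move=> gh x; rewrite -[x]freeg_sumE !raddf_sum; apply: eq_bigr => t _ /=.
have -> : << coeff t x *g t >> = coeff t x *: << t >> :> {freeg T / S}.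
  by apply/eqP/freeg_eqP => s; rewrite coeffZ !coeffU mul1r.
by rewrite !linearZ /= gh.
Qed.

Lemma tensor_linear_ext (M N V : lmodType S) (g h : {linear tensor M N -> V}) :
  (forall m n, g (tens m n) = h (tens m n)) -> g =1 h.
Proof.
move=> gh x; have [y ->] := quotmod_piP x.
apply: (@freeg_linear_ext _ _ (g \o quotmod_pi _) (h \o quotmod_pi _)).
by case=> m n; exact: gh.
Qed.

Lemma tensor_map_linear (M N N' : lmodType S) (f : {linear N -> N'}) :
  linear (tensor_map (M := M) f).
Proof.
move=> a x y; have [u ->] := quotmod_piP x; have [v ->] := quotmod_piP y.
by rewrite -linearP !tensor_map_pi linearP.
Qed.

Lemma tensor_map_pure (M N N' : lmodType S) (f : {linear N -> N'}) m n :
  tensor_map f (tens m n) = tens m (f n) :> tensor M N'.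
Proof. by rewrite tensor_map_pi free_tensor_map_pure. Qed.

(** The map phi (x) id_N, followed by the identification of S (x) N with N. *)
Lemma tensor_contract (M N : lmodType S) (phi : {linear M -> S^o}) :
  exists c : {linear tensor M N -> N},
    forall m n, c (tens m n) = (phi m : S) *: n.
Proof.
pose b (mn : M * N) : N := (phi mn.1 : S) *: mn.2.
pose Lb := GRing.isLinear.Build S {freeg (M * N)%type / S} N *:%R (fglift b)
  (fglift_is_linear b).
pose g : {linear {freeg (M * N)%type / S} -> N} := HB.pack (fglift b) Lb.
have gE m n :
    fglift b (free_tens m n : {freeg (M * N)%type / S}) = (phi m : S) *: n.
  by rewrite liftU scale1r.
pose kerg : {pred {freeg (M * N)%type / S}} := fun x => g x == 0.
have kerg_closed : submod_closed kerg.
  split=> [|a x y /eqP gx /eqP gy]; apply/eqP; first exact: linear0.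
  by rewrite linearP gx gy scaler0 addr0.
pose Lk := GRing.isSubmodClosed.Build S _ kerg
  (GRing.submod_closed_semi kerg_closed).
pose kerS : submodClosed {freeg (M * N)%type / S} := HB.pack kerg Lk.
have [x|c cE] := @quotmod_lift S _ _ (spanmod (@bilin_rel S M N)) g.
  move=> /asboolP/(_ kerS) xk.
  apply/eqP/xk => {x xk} _ [m m' n|m n n'|a m n|a m n]; apply/eqP.
  - by rewrite linearB linearD /= !gE linearD scalerDl subrr.
  - by rewrite linearB linearD /= !gE scalerDr subrr.
  - by rewrite linearB linearZ /= !gE linearZ scalerA subrr.
  - by rewrite linearB linearZ /= !gE !scalerA mulrC subrr.
by exists c => m n; exact: etrans (cE _) (gE m n).
Qed.

(** * Flatness of finitely generated projective modules *)

(** Naturality of contraction reduces the injectivity of id (x) f to that of f: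
every x equals the sum of the b_j (x) c_j x, where c_j contracts with phi_j. *)
Lemma flat_of_dual_basis (M : lmodType S) (n : nat) (b : 'I_n -> M)
    (phi : 'I_n -> {linear M -> S^o}) :
  (forall m, m = \sum_j (phi j m : S) *: b j) -> flat M.
Proof.
move=> bphi N N' f finj.
have [c cE] := fin_all_exists (fun j => tensor_contract N (phi j)).
have [c' c'E] := fin_all_exists (fun j => tensor_contract N' (phi j)).
pose Lf := GRing.isLinear.Build S (tensor M N) (tensor M N') *:%R
  (tensor_map f) (tensor_map_linear f).
pose tf : {linear tensor M N -> tensor M N'} := HB.pack (tensor_map f) Lf.
have nat_c j x : c' j (tensor_map f x) = f (c j x).
  apply: (@tensor_linear_ext _ _ _ (c' j \o tf) (f \o c j)) => m y /=.
  by rewrite tensor_map_pure c'E cE linearZ.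
pose s x : tensor M N := \sum_j tens (b j) (c j x).
have s_lin : linear s.
  move=> a x y; rewrite /s scaler_sumr -big_split; apply: eq_bigr => j _ /=.
  by rewrite linearP tensDr tensZr.
pose Ls := GRing.isLinear.Build S (tensor M N) (tensor M N) *:%R s s_lin.
pose sL : {linear tensor M N -> tensor M N} := HB.pack s Ls.
have recover x : s x = x.
  apply: (@tensor_linear_ext _ _ _ sL idfun) => m y /=; rewrite /s.
  rewrite [in RHS](bphi m).
  rewrite (big_morph (fun m => tens m y) (fun m m' => tensDl m m' y) (_ : _ = 0)).
    by apply: eq_bigr => j _; rewrite cE tensZr tensZl.
  by rewrite -(scale0r 0) tensZl scale0r.
move=> x y xy; rewrite -(recover x) -(recover y); apply: eq_bigr => j _.
by congr tens; apply: finj; rewrite -!nat_c xy.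
Qed.

(** The idempotent e induces an embedding of the quotient into S^n that splits
the projection, so the classes of the unit vectors and the coordinates of e v
form a dual basis. *)
Lemma flat_quotmod_idempotent (n : nat) (e : 'M[S]_n)
    (U : submodClosed 'cV[S]_n) :
  e *m e = e -> (forall v, v \in U <-> e *m v = 0) -> flat (quotmod U).
Proof.
move=> ee Ue.
pose g j (v : 'cV[S]_n) : S^o := (e *m v) j 0.
have g_lin j : linear (g j).
  by move=> a u v; rewrite /g mulmxDr -scalemxAr !mxE.
pose Lg j := GRing.isLinear.Build S 'cV[S]_n S^o *:%R (g j) (g_lin j).
pose gL j : {linear 'cV[S]_n -> S^o} := HB.pack (g j) (Lg j).
have gU j u : u \in U -> gL j u = 0 by move=> /Ue eu; rewrite /= /g eu mxE.
have [phi phiE] := fin_all_exists (fun j => quotmod_lift (gU j)).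
apply: (@flat_of_dual_basis _ n (fun j => quotmod_pi U (delta_mx j 0)) phi) => x.
have [v ->] := quotmod_piP x.
transitivity (quotmod_pi U (e *m v)).
  by apply/quotmod_pi_eq/Ue; rewrite mulmxBr mulmxA ee subrr.
rewrite [e *m v]matrix_sum_delta raddf_sum; apply: eq_bigr => j _ /=.
by rewrite big_ord1 linearZ /= phiE.
Qed.

(** * Kernels of pairs with a left invertible first member *)

Lemma mx_surjective_rinv m n (A : 'M[S]_(m, n)) :
  mx_surjective A -> exists T, A *m T = 1%:M.
Proof.
move=> surjA.
have [T TE] := fin_all_exists (fun j => surjA (col j 1%:M)).
exists (\matrix_(i, j) T j i 0); apply/matrixP => i j.
have := congr1 (fun X : 'cV_m => X i 0) (TE j); rewrite !mxE => <-.
by apply: eq_bigr => l _; rewrite mxE.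
Qed.

(** The pair (p, M) identifies the quotient with the cokernel of p, which is
projective since p has a left inverse. The proof makes this explicit: the
quotient is cut out by an idempotent matrix. *)
Lemma flat_quotmod_kerpair q m n (p : 'M[S]_(q, m)) (M : 'M[S]_(q, n))
    (N : 'M[S]_(m, q)) (U : submodClosed 'cV[S]_n) :
    N *m p = 1%:M -> mx_surjective (row_mx p M) ->
    (forall v, v \in U <-> kerpair p M v) ->
  flat (quotmod U).
Proof.
move=> Np /mx_surjective_rinv [T pMT] Uker.
(* c has kernel exactly the image of p, so v lies in Ker(p | M) iff c M v = 0. *)
pose c := 1%:M - p *m N.
have cp : c *m p = 0 by rewrite mulmxBl mul1mx -mulmxA Np mulmx1 subrr.
(* c kills p, so multiplying p T1 + M T2 = 1 by c leaves c M T2 = c, and c is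
   idempotent. *)
have cMT : c *m M *m dsubmx T *m c = c.
  move: pMT; rewrite -{1}[T]vsubmxK mul_row_col => /(congr1 (mulmx c)).
  rewrite mulmxDr mulmxA cp mul0mx add0r mulmx1 mulmxA => ->.
  by rewrite {2}/c mulmxBr mulmx1 mulmxA cp mul0mx subr0.
apply: (@flat_quotmod_idempotent _ (dsubmx T *m (c *m M))) => [|v].
  by rewrite -!mulmxA (mulmxA c M) (mulmxA (c *m M)) (mulmxA _ c M) cMT.
rewrite Uker; split=> [[u /eqP]|ev0].
  rewrite addrC addr_eq0 => /eqP Mv.
  by rewrite -!mulmxA Mv mulmxN (mulmxA c) cp mul0mx oppr0 mulmx0.
have : c *m (M *m v) = 0.
  by rewrite -cMT -!mulmxA; move: ev0; rewrite -!mulmxA => ->; rewrite !mulmx0.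
rewrite mulmxBl mul1mx -mulmxA => cMv.
by exists (- (N *m (M *m v))); rewrite mulmxN addrC.
Qed.

End Tensors.

(** * Observability and the pencil *)

(** A is congruent to z modulo left multiples of A - z. Inducting for all C at
once, with C A in place of C, avoids commuting A with A - z. *)
Lemma mulmx_exp_pencil (R : comNzRingType) d r (A : 'M[R]_d)
    (C : 'M[R]_(r, d)) i :
  exists Q, map_mx polyC (C *m A ^+ i) =
    'X^i *: map_mx polyC C + Q *m (map_mx polyC A - 'X%:M).
Proof.
elim: i C => [|i IHi] C.
  by exists 0; rewrite expr0 mulmx1 scale1r mul0mx addr0.
have [Q CAi] := IHi (C *m A).
exists ('X^i *: map_mx polyC C + Q).
rewrite exprS -mulmxE mulmxA CAi mulmxDl addrA; congr (_ + _).
rewrite map_mxM -scalemxAl mulmxBr mul_mx_scalar scalerBr scalerA -exprSr.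
by rewrite addrC subrK.
Qed.

(** One direction of the Hautus test, in the form of a left inverse. *)
Lemma observability_linv_pencil (R : comNzRingType) d r
    (A : 'M[R]_d) (C : 'M[R]_(r, d)) Y :
  Y *m observability_mx A C = 1%:M ->
  exists N, N *m col_mx (map_mx polyC A - 'X%:M) (map_mx polyC C) = 1%:M.
Proof.
move=> YO.
have [Q QE] := fin_all_exists (fun i : 'I_d => mulmx_exp_pencil A C i).
pose Yi (i : 'I_d) := map_mx polyC (submxrow Y i).
exists (row_mx (\sum_(i < d) Yi i *m Q i) (\sum_(i < d) 'X^i *: Yi i)).
rewrite mul_row_col !mulmx_suml -big_split /= -[RHS](map_mx1 polyC) -YO.
rewrite -[in RHS](submxrowK Y) mul_mxrow_mxcol map_mx_sum; apply: eq_bigr => i _.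
by rewrite map_mxM QE -/(Yi i) [RHS]mulmxDr mulmxA -scalemxAr scalemxAl addrC.
Qed.

(** Left inverses over the factors F_j glue to one over the product, so it is
enough that A stays injective over each F_j; this holds because a vector over
F_j extends by zero to the other factors. *)
Lemma field_prod_mx_injective_linv (t : nat) (F : 'I_t.+1 -> finFieldType) m n
    (A : 'M[field_prod F]_(m, n)) :
  mx_injective A -> exists N, N *m A = 1%:M.
Proof.
move=> injA.
pose Aj j := map_mx (@prod_proj t F j) A.
have full j : row_full (Aj j).
  rewrite -[Aj j]trmxK /row_full mxrank_tr; apply: inj_row_free => v vA0.
  pose w : 'cV[field_prod F]_n := \col_i prod_tuple (dfwith (fun=> 0) (v 0 i)).
  have w0 : w = 0.
    apply: injA; rewrite mulmx0; apply/matrixP => i c; apply: prod_ext => l.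
    rewrite mxE rmorph_sum; under eq_bigr => h _ do rewrite rmorphM mxE /= prod_tupleE.
    rewrite mxE rmorph0; have [->{l}|lj] := eqVneq l j.
      have := congr1 (fun X : 'rV_m => X 0 i) vA0; rewrite !mxE => vA0i.
      rewrite -[RHS]vA0i.
      by apply: eq_bigr => h _; rewrite dfwith_in !mxE mulrC.
    by rewrite big1 // => h _; rewrite dfwith_out ?mulr0 // eq_sym.
  apply/rowP => i; have := congr1 (fun X : 'cV_n => prod_proj j (X i 0)) w0.
  by rewrite !mxE prod_tupleE dfwith_in rmorph0.
exists (\matrix_(i, l) prod_tuple (fun j => pinvmx (Aj j) i l)).
apply/matrixP => i l; apply: prod_ext => j.
have := congr1 (fun X : 'M_n => X i l) (mulVpmx (full j)).
rewrite !mxE rmorph_sum rmorph_nat => <-; apply: eq_bigr => h _.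
by rewrite rmorphM mxE [Aj j h l]mxE /= prod_tupleE.
Qed.

Theorem proposition5p1 (t : nat) (F : 'I_t.+1 -> finFieldType)
    (n k delta : nat) (le_kn : (k <= n)%N)
    (CC : submodClosed 'cV[{poly field_prod F}]_n)
    (hCC : conv_code k CC) (hdeg : constant_degree k CC delta)
    (A : 'M[field_prod F]_delta) (B : 'M[field_prod F]_(delta, k))
    (C : 'M[field_prod F]_(n - k, delta)) (D : 'M[field_prod F]_(n - k, k))
    (hABCD : iso_representation le_kn CC A B C D)
    (hreach : reachable A B) (hobs : observable A C) :
  observable_conv_code k CC.
Proof.
split=> //.
have [K [L [M [W [P [[CCker [_ _ surj]] _ _ [WK WL _]]]]]]] := hABCD.
have [Y YO] := field_prod_mx_injective_linv hobs.
have [N NAC] := observability_linv_pencil YO.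
have linv : (N *m map_mx polyC W) *m pencil K L = 1%:M.
  rewrite -mulmxA -NAC /pencil mulmxDr -scalemxAr -!map_mxM WK WL.
  rewrite !map_col_mx map_mxN map_mx1 map_mx0 scale_col_mx scaler0.
  by rewrite add_col_mx add0r scalerN scalemx1 addrC.
exact: flat_quotmod_kerpair linv surj CCker.
Qed.
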